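(* Assume: (A1) $A$ and $B$ are continuously differentiable and there exist $L_A,L_B\in(0,\infty)$ such that for all $x,\hat x\in\mathbb R^n$, $u,\hat u\in\mathbb R^m$, $\|A(x,u)-A(\hat x,\hat u)\|\le L_A(\|x-\hat x\|+\|u-\hat u\|)$ and $\|B(x,u)-B(\hat x,\hat u)\|\le L_B(\|x-\hat x\|+\|u-\hat u\|)$; (A3) with $A_0=A(0,0)$, $B_0=B(0,0)$, the pair $(A_0,B_0)$ is stabilizable and the pair $(A_0,Q^{1/2})$ is detectable; and that $Q$ is positive definite, $0\in\mathrm{int}\,\mathcal X$, and $0\in\mathrm{int}\,\mathcal U$. Consider the system $x_{k+1}=f(x_k,u_k)$ under receding-horizon control $u_{k+1}=u_{k,1}$, where at each step $k$ the applied sequence $(u_{k,1},\ldots,u_{k,\ell-1})$ is a minimizer of ${\rm OCP}_k$. Let $z_0\in\mathcal F_\ell$. Then $z_k\in\mathcal F_\ell$ for all $k\in\mathbb N$.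
   Context: $\mathbb N=\{0,1,2,\ldots\}$; $\|\cdot\|$ is the Euclidean norm on vectors and the induced norm on matrices. System: $f(x,u)=A(x,u)x+B(x,u)u$ for all $x\in\mathbb R^n$, $u\in\mathbb R^m$, with $A:\mathbb R^n\times\mathbb R^m\to\mathbb R^{n\times n}$, $B:\mathbb R^n\times\mathbb R^m\to\mathbb R^{n\times m}$; $x_0,u_0$ are given. $\mathcal X\subseteq\mathbb R^n$ and $\mathcal U\subseteq\mathbb R^m$ are closed. The horizon is an integer $\ell\ge2$. $Q\in\mathbb R^{n\times n}$ and $R\in\mathbb R^{m\times m}$ are symmetric, $R$ positive definite. The extended state is $z_k=(x_k,u_k)\in\mathbb R^{n+m}$. Terminal ingredients: $P$ is the unique (positive definite) stabilizing solution of $P=A_0^TPA_0-A_0^TPB_0(2R+B_0^TPB_0)^{-1}B_0^TPA_0+2Q$; $K_{\rm f}=-(2R+B_0^TPB_0)^{-1}B_0^TPA_0$; $\kappa_{\rm f}(x)=K_{\rm f}x$; $V_{\rm f}(x)=x^TPx$; and $\mathcal X_{\rm f}=\{x\in\mathbb R^n:V_{\rm f}(x)\le\alpha\}$, where $\alpha\in(0,\infty)$ is such that (i) $\mathcal X_{\rm f}\subseteq\mathcal X$ and $\kappa_{\rm f}(x)\in\mathcal U$ for all $x\in\mathcal X_{\rm f}$; (ii) $f(x,\kappa_{\rm f}(x))\in\mathcal X_{\rm f}$ for all $x\in\mathcal X_{\rm f}$; (iii) $V_{\rm f}(f(x,\kappa_{\rm f}(x)))-V_{\rm f}(x)\le-x^TQx-\kappa_{\rm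 f}(x)^TR\kappa_{\rm f}(x)$ for all $x\in\mathcal X_{\rm f}$. (Under the stated assumptions such an $\alpha$ exists.) Optimal control problem: given $(x_k,u_k)$, set $x_{k,1}=f(x_k,u_k)$ (so the first predicted state is not influenced by the optimization; the applied control is delayed by one step, and $x_{k+1}=x_{k,1}$). ${\rm OCP}_k$ is: minimize over $(u_{k,1},\ldots,u_{k,\ell-1})$ the cost $J_k=\tfrac12x_{k,\ell}^TPx_{k,\ell}+\tfrac12\sum_{j=1}^{\ell-1}(x_{k,j}^TQx_{k,j}+u_{k,j}^TRu_{k,j})$ subject to $x_{k,j+1}=f(x_{k,j},u_{k,j})$ for $j\in\{1,\ldots,\ell-1\}$, $x_{k,j}\in\mathcal X$ for $j\in\{1,\ldots,\ell\}$, $u_{k,j}\in\mathcal U$ for $j\in\{1,\ldots,\ell-1\}$, and $x_{k,\ell}\in\mathcal X_{\rm f}$. Feasible set: $\mathcal F_\ell$ is the set of $(x,u)\in\mathbb R^{n+m}$ for which there exist $u_1,\ldots,u_{\ell-1}\in\mathcal U$ such that, with $x_1=f(x,u)$ and $x_{j+1}=f(x_j,u_j)$, one has $x_j\in\mathcal X$ for all $j\in\{1,\ldots,\ell-1\}$ and $x_\ell\in\mathcal X_{\rm f}$. *)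

(* Defs.v *)
From HB Require Import structures.
From mathcomp Require Import all_boot all_order all_algebra.
From mathcomp Require Import complex.
From mathcomp Require Import all_classical all_reals all_analysis.

Set Implicit Arguments.
Unset Strict Implicit.
Unset Printing Implicit Defensive.

Import Order.TTheory GRing.Theory Num.Theory.
Import numFieldNormedType.Exports.

Local Open Scope classical_set_scope.
Local Open Scope ring_scope.

Section LinearAlgebra.
Variable R : realType.

(* MathComp-Analysis equips matrices with the entrywise sup norm `|_|; the
   Euclidean norm and the operator norm it induces are therefore spelled out.
   The topology is the same. *)
Definition enorm p (x : 'cV[R]_p) : R := Num.sqrt (\sum_i x i 0 ^+ 2).

Definition opnorm p q (M : 'M[R]_(p, q)) : R :=
  sup [set enorm (M *m x) | x in [set x : 'cV[R]_q | enorm x <= 1]].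

Definition qform p (M : 'M[R]_p) (x : 'cV[R]_p) : R := (x^T *m M *m x) 0 0.

Definition posdef p (M : 'M[R]_p) : Prop :=
  forall x : 'cV[R]_p, x != 0 -> 0 < qform M x.

Definition possemidef p (M : 'M[R]_p) : Prop :=
  forall x : 'cV[R]_p, 0 <= qform M x.

(* S is the square root M^(1/2) of a symmetric matrix M. *)
Definition is_sqrtmx p (M S : 'M[R]_p) : Prop :=
  [/\ S^T = S, possemidef S & S *m S = M].

(* Discrete-time stability: all complex eigenvalues in the open unit disk. *)
Definition schur_stable p (M : 'M[R]_p) : Prop :=
  forall a : R[i], eigenvalue (map_mx (real_complex R) M) a -> `|a| < 1.

Definition stabilizable p q (A : 'M[R]_p) (B : 'M[R]_(p, q)) : Prop :=
  exists K : 'M[R]_(q, p), schur_stable (A + B *m K).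

Definition detectable p q (A : 'M[R]_p) (C : 'M[R]_(q, p)) : Prop :=
  exists L : 'M[R]_(p, q), schur_stable (A + L *m C).

(* On a finite-dimensional space, continuity of p |-> 'd F p in operator norm
   is continuity of p |-> 'd F p v for each direction v. *)
Definition continuously_differentiable (V W : normedModType R) (F : V -> W) :
    Prop :=
  (forall p, differentiable F p) /\ (forall v, continuous (fun p => 'd F p v)).

Definition lipschitz_mx n m p q (L : R)
    (M : 'cV[R]_n -> 'cV[R]_m -> 'M[R]_(p, q)) : Prop :=
  forall x x' u u',
    opnorm (M x u - M x' u') <= L * (enorm (x - x') + enorm (u - u')).

End LinearAlgebra.

Section Terminal.
Variables (R : realType) (n m : nat).
Variables (A0 : 'M[R]_n) (B0 : 'M[R]_(n, m)) (Q : 'M[R]_n) (Rm : 'M[R]_m).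

Definition gain (P : 'M[R]_n) : 'M[R]_(m, n) :=
  - (invmx (2 *: Rm + B0^T *m P *m B0) *m B0^T *m P *m A0).

Definition stabilizing_solution (P : 'M[R]_n) : Prop :=
  [/\ P^T = P, posdef P,
      P = A0^T *m P *m A0
          - A0^T *m P *m B0 *m invmx (2 *: Rm + B0^T *m P *m B0)
              *m B0^T *m P *m A0
          + 2 *: Q
    & schur_stable (A0 + B0 *m gain P)].

End Terminal.

Section ControlProblem.
Variables (R : realType) (n m : nat).
Variables (A : 'cV[R]_n -> 'cV[R]_m -> 'M[R]_n).
Variables (B : 'cV[R]_n -> 'cV[R]_m -> 'M[R]_(n, m)).

Definition dyn (x : 'cV[R]_n) (u : 'cV[R]_m) : 'cV[R]_n :=
  A x u *m x + B x u *m u.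

Definition sublevel (P : 'M[R]_n) (alpha : R) : set 'cV[R]_n :=
  [set x | qform P x <= alpha].

(* Constraint satisfaction, invariance and cost decrease on the terminal set
   sublevel P alpha under the feedback K. *)
Definition terminal_conditions (Q : 'M[R]_n) (Rm : 'M[R]_m)
    (X : set 'cV[R]_n) (U : set 'cV[R]_m)
    (P : 'M[R]_n) (K : 'M[R]_(m, n)) (alpha : R) : Prop :=
  [/\ sublevel P alpha `<=` X /\
        (forall x, sublevel P alpha x -> U (K *m x)),
      (forall x, sublevel P alpha x -> sublevel P alpha (dyn x (K *m x)))
    & (forall x, sublevel P alpha x ->
         qform P (dyn x (K *m x)) - qform P x
           <= - qform Q x - qform Rm (K *m x))].

(* Control sequences (v_1, ..., v_{l-1}) are represented by v : nat -> 'cV_m;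
   v 0 and v j for j >= l are never used below.
   predicted z v j is x_{k,j} for z = (x_k, u_k), with x_{k,0} = x_k: the first
   step uses the given input z.2, the following ones use v. *)
Fixpoint predicted (z : 'cV[R]_n * 'cV[R]_m) (v : nat -> 'cV[R]_m) (j : nat) :
    'cV[R]_n :=
  match j with
  | 0 => z.1
  | 1 => dyn z.1 z.2
  | (i.+1 as j').+1 => dyn (predicted z v j') (v j')
  end.

Variables (X Xf : set 'cV[R]_n) (U : set 'cV[R]_m) (l : nat).

Definition feasible_set : set ('cV[R]_n * 'cV[R]_m) :=
  [set z | exists v : nat -> 'cV[R]_m,
    [/\ forall j, (1 <= j <= l.-1)%N -> U (v j),
        forall j, (1 <= j <= l.-1)%N -> X (predicted z v j)
      & Xf (predicted z v l)]].

Variables (Q P : 'M[R]_n) (Rm : 'M[R]_m).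

Definition ocp_admissible (z : 'cV[R]_n * 'cV[R]_m) (v : nat -> 'cV[R]_m) :
    Prop :=
  [/\ forall j, (1 <= j <= l)%N -> X (predicted z v j),
      forall j, (1 <= j <= l.-1)%N -> U (v j)
    & Xf (predicted z v l)].

Definition ocp_cost (z : 'cV[R]_n * 'cV[R]_m) (v : nat -> 'cV[R]_m) : R :=
  2^-1 * qform P (predicted z v l)
  + 2^-1 * \sum_(1 <= j < l) (qform Q (predicted z v j) + qform Rm (v j)).

Definition ocp_minimizer (z : 'cV[R]_n * 'cV[R]_m) (v : nat -> 'cV[R]_m) :
    Prop :=
  ocp_admissible z v /\
  forall w, ocp_admissible z w -> ocp_cost z v <= ocp_cost z w.

(* v k j is the predicted input u_{k,j}.  The sequence applied at step k is
   required to be a minimizer only when the problem at step k has one: an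
   unconditional requirement would postulate that every z_k is feasible. *)
Definition receding_horizon (x : nat -> 'cV[R]_n) (u : nat -> 'cV[R]_m)
    (v : nat -> nat -> 'cV[R]_m) : Prop :=
  forall k,
    [/\ x k.+1 = dyn (x k) (u k),
        u k.+1 = v k 1%N
      & (exists w, ocp_minimizer (x k, u k) w) ->
        ocp_minimizer (x k, u k) (v k)].

End ControlProblem.

(* Main.v *)
Require Import Defs.
From HB Require Import structures.
From mathcomp Require Import all_boot all_order all_algebra.
From mathcomp Require Import complex.
From mathcomp Require Import lra.
From mathcomp Require Import all_classical all_reals all_analysis.
Set Implicit Arguments.
Unset Strict Implicit.

Import Order.TTheory GRing.Theory Num.Theory.
Import numFieldNormedType.Exports.
Local Open Scope classical_set_scope.
Local Open Scope ring_scope.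

(** Feasibility is handed from one step to the next by the classical
    shift-and-append argument.  If v is admissible for z = (x, u), its prediction
    ends at x_l in the terminal set Xf.  The closed loop moves to
    z' = (dyn x u, v 1); the inputs v 2, ..., v (l-1) followed by the terminal
    feedback K x_l drive z' along the tail of the old prediction and then by one
    step of the terminal controller, which keeps the state in Xf and satisfies
    the input constraint.  This is [feasible_set_next].

    The applied sequence is known to be admissible once the problem has some
    minimizer.  Hence the substantial part is [ocp_minimizer_exists]: on a
    feasible z the minimum is attained.  The states are continuous functions of
    the inputs, so the cost is continuous and the admissible sequences form a
    closed set.  Since Rm is positive definite and the other terms of the cost are
    nonnegative, a bound on the cost bounds every input that enters it
    ([posdef_sublevel_bounded], [qform_input_le_cost]).  The search may thus be
    restricted to a product of closed balls, which is compact by Tychonoff's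
    theorem, and the extreme value theorem applies.  Input sequences are points
    of the product space of maps from nat to column vectors; the entries that do
    not enter the problem are set to zero to bring a sequence into the
    product of balls ([truncated]). *)

(** * Continuity and compactness for matrices *)

(** A basic neighbourhood of a matrix is a finite family of neighbourhoods of
    its entries, and a finite intersection stays in the filter. *)
Lemma continuous_mx (T K : topologicalType) p q (f : T -> 'M[K]_(p, q)) :
  (forall i j, continuous (fun t => f t i j)) -> continuous f.
Proof.
move=> fc t W [V tV VW].
apply: (@filterS _ (nbhs t) _ [set s | forall i j, V i j (f s i j)]).
  by move=> s Vfs; apply: VW.
apply: filter_forall => i; apply: filter_forall => j.
exact: fc (tV i j).
Qed.

Lemma continuous_coord (R : realType) (T : topologicalType) p q
    (f : T -> 'M[R]_(p, q)) i j :
  continuous f -> continuous (fun t => f t i j).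
Proof.
move=> fc t; apply: (@continuous_comp _ _ _ f (fun M : 'M[R]_(p, q) => M i j)).
  exact: fc.
exact: coord_continuous.
Qed.

Lemma continuous_sum (R : realType) (T : topologicalType) (I : Type) (r : seq I)
    (f : I -> T -> R) :
  (forall i, continuous (f i)) -> continuous (fun t => \sum_(i <- r) f i t).
Proof.
move=> fc t; apply: cvg_big => [|i _]; first exact: add_continuous.
exact: fc.
Qed.

Lemma continuous_mulmx (R : realType) (T : topologicalType) p q r
    (f : T -> 'M[R]_(p, q)) (g : T -> 'M[R]_(q, r)) :
  continuous f -> continuous g -> continuous (fun t => f t *m g t).
Proof.
move=> fc gc; apply: continuous_mx => i k.
under eq_fun do rewrite mxE.
by apply: continuous_sum => j t; apply: cvgM; apply: continuous_coord.
Qed.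

Lemma continuous_trmx (R : realType) p q : continuous (@trmx R p q).
Proof.
apply: continuous_mx => i j; under eq_fun do rewrite mxE.
exact: coord_continuous.
Qed.

Lemma continuous_qform (R : realType) p (M : 'M[R]_p) : continuous (qform M).
Proof.
apply: continuous_coord; apply: (continuous_mulmx (g := id)); last by move=> x; exact: cvg_id.
by apply: continuous_mulmx; [exact: continuous_trmx|exact: cst_continuous].
Qed.

Lemma norm_trmx (R : realType) p q (M : 'M[R]_(p, q)) : `|M^T| = `|M|.
Proof.
suff le r s (N : 'M[R]_(r, s)) : `|N^T| <= `|N|.
  by apply/eqP; rewrite eq_le le /= -{1}[M]trmxK le.
have [/mx_norm_neq0[[i j] /= e]|] := boolP (`|N^T| != 0); last first.
  by rewrite negbK => /eqP ->.
rewrite [leLHS]e mxE [leRHS]/Num.norm /= mx_normrE.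
by apply/bigmax_geP; right; exists (j, i).
Qed.

(** Transposition is a continuous isometry, so the Heine-Borel property of row
    vectors carries over. *)
Lemma bounded_closed_compact_cV (R : realType) p (S : set 'cV[R]_p) :
  bounded_set S -> closed S -> compact S.
Proof.
move=> [c [cr Sc]] Scl.
have -> : S = trmx @` [set y : 'rV[R]_p | S y^T].
  apply/seteqP; split=> [x Sx|_ [y Sy <-]//].
  by exists x^T; rewrite /= ?trmxK.
apply: continuous_compact; first exact/continuous_subspaceT/continuous_trmx.
apply: bounded_closed_compact.
  by exists c; split=> // d cd y Sy; rewrite /= -norm_trmx; exact: Sc.
by have /continuous_closedP := @continuous_trmx R 1 p; exact.
Qed.

(** * Positive definite quadratic forms *)

Lemma qform0 (R : realType) p (M : 'M[R]_p) : qform M 0 = 0.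
Proof. by rewrite /qform mulmx0 mxE. Qed.

Lemma qformZ (R : realType) p (M : 'M[R]_p) a x :
  qform M (a *: x) = a ^+ 2 * qform M x.
Proof.
by rewrite /qform -scalemxAr [_^T]linearZ /= -!scalemxAl scalerA mxE expr2.
Qed.

Lemma posdef_possemidef (R : realType) p (M : 'M[R]_p) :
  posdef M -> possemidef M.
Proof.
by move=> Mpos x; have [->|/Mpos/ltW//] := eqVneq x 0; rewrite qform0.
Qed.

(** Coercivity: the form attains a positive minimum mu on the compact unit
    sphere, so by homogeneity mu * |x|^2 <= qform M x.  In dimension zero the
    sphere is empty and the only vector is 0. *)
Lemma posdef_sublevel_bounded (R : realType) p (M : 'M[R]_p) (a : R) :
  posdef M -> exists c : R, forall x, qform M x <= a -> `|x| <= c.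
Proof.
move=> Mpos; pose S := [set x : 'cV[R]_p | `|x| = 1].
have Scompact : compact S.
  apply: bounded_closed_compact_cV.
    by exists 1; split=> // d d1 x /= ->; exact: ltW.
  have /continuous_closedP : continuous (fun x : 'cV[R]_p => `|x|).
    exact: norm_continuous.
  by move=> /(_ [set 1]); apply; exact: closed_eq.
have normalized x : x != 0 -> S (`|x|^-1 *: x).
  by move=> x0; rewrite /S /= normrZ normfV normr_id mulVf ?normr_eq0.
have [S0|/set0P/compact_EVT_min/(_ Scompact)] := eqVneq S set0.
  exists 0 => x _; have [->|/normalized] := eqVneq x 0; first by rewrite normr0.
  by rewrite S0.
move=> /(_ R (qform M)) [|e /set_mem Se emin].
  by apply: continuous_subspaceT; exact: continuous_qform.
have qe : 0 < qform M e.
  by apply: Mpos; apply/eqP => e0; move: Se; rewrite /S /= e0 normr0 => /eqP;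
    rewrite eq_sym oner_eq0.
exists (1 + a / qform M e) => x xa.
have growth : qform M e * `|x| ^+ 2 <= a.
  have [->|x0] := eqVneq x 0.
    rewrite normr0 expr0n mulr0; apply: le_trans xa.
    exact: posdef_possemidef.
  apply: le_trans xa; have nx0 : 0 < `|x| by rewrite normr_gt0.
  rewrite -ler_pdivlMr ?exprn_gt0// mulrC -exprVn -qformZ.
  exact/emin/mem_set/normalized.
(* The bound follows from |x| <= 1 + |x|^2, which avoids a square root. *)
rewrite -lerBlDl ler_pdivlMr// (le_trans _ growth)// mulrC ler_pM2l//.
nra.
Qed.

(** * The optimal control problem has a minimizer *)

Lemma predictedS (R : realType) n m (A : 'cV[R]_n -> 'cV[R]_m -> 'M[R]_n)
    (B : 'cV[R]_n -> 'cV[R]_m -> 'M[R]_(n, m)) z v j :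
  predicted A B z v j.+2 = dyn A B (predicted A B z v j.+1) (v j.+1).
Proof. by []. Qed.

(** The first step uses the given input z.2 and step i uses v i, so x_j only
    depends on v 1, ..., v (j-1). *)
Lemma predicted_ext (R : realType) n m (A : 'cV[R]_n -> 'cV[R]_m -> 'M[R]_n)
    (B : 'cV[R]_n -> 'cV[R]_m -> 'M[R]_(n, m)) z v w j :
  (forall i, (1 <= i < j)%N -> v i = w i) ->
  predicted A B z v j = predicted A B z w j.
Proof.
elim: j => [//|[//|j] IH] vw; rewrite !predictedS vw ?leqnn// IH// => i /andP[i1 ij].
by rewrite vw// i1 ltnW.
Qed.

(** The inputs range over an arbitrary space of parameters, rather than over
    the product space, to keep the topology abstract. *)
Lemma continuous_predicted (R : realType) n m
    (A : 'cV[R]_n -> 'cV[R]_m -> 'M[R]_n)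
    (B : 'cV[R]_n -> 'cV[R]_m -> 'M[R]_(n, m)) z (T : topologicalType)
    (v : T -> nat -> 'cV[R]_m) j :
  continuous (fun y : 'cV[R]_n * 'cV[R]_m => dyn A B y.1 y.2) ->
  (forall i, continuous (v^~ i)) ->
  continuous (fun t => predicted A B z (v t) j).
Proof.
move=> fc vc; elim: j => [|[|j] IH]; [exact: cst_continuous..|] => t.
apply: (@continuous2_cvg _ _ _ _ (nbhs t) _
  (fun s => predicted A B z (v s) j.+1) (v^~ j.+1) (dyn A B)).
- exact: fc (_, _).
- exact: IH.
- exact: vc.
Qed.

Section Existence.
Variables (R : realType) (n m l : nat).
Variables (A : 'cV[R]_n -> 'cV[R]_m -> 'M[R]_n).
Variables (B : 'cV[R]_n -> 'cV[R]_m -> 'M[R]_(n, m)).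
Variables (X Xf : set 'cV[R]_n) (U : set 'cV[R]_m).
Variables (Q P : 'M[R]_n) (Rm : 'M[R]_m).

(** The optimization variables are v 1, ..., v (l-1); the other entries of a
    sequence can grow without changing the cost, so a bound on the cost bounds
    the truncated sequence only. *)
Definition truncated (v : nat -> 'cV[R]_m) (j : nat) : 'cV[R]_m :=
  if (1 <= j < l)%N then v j else 0.

Lemma predicted_truncated z v j : (j <= l)%N ->
  predicted A B z (truncated v) j = predicted A B z v j.
Proof.
move=> jl; apply: predicted_ext => i /andP[i1 ij].
by rewrite /truncated i1 (leq_trans ij jl).
Qed.

Lemma ocp_cost_truncated z v :
  ocp_cost A B l Q P Rm z (truncated v) = ocp_cost A B l Q P Rm z v.
Proof.
rewrite /ocp_cost predicted_truncated//; congr (_ + _ * _).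
apply: eq_big_nat => j jl; rewrite predicted_truncated; last first.
  by case/andP: jl => _ /ltnW.
by rewrite /truncated jl.
Qed.

Hypothesis l2 : (2 <= l)%N.

Lemma ocp_admissible_truncated z v :
  ocp_admissible A B X Xf U l z v -> ocp_admissible A B X Xf U l z (truncated v).
Proof.
move=> [vX vU vXf]; split=> [j jl|j jl|]; last by rewrite predicted_truncated.
  by case/andP: (jl) => _ ?; rewrite predicted_truncated//; exact: vX.
rewrite /truncated ifT; first exact: vU.
by have -> : (j < l)%N = (j <= l.-1)%N by rewrite -[in RHS]ltnS prednK// ltnW.
Qed.

Hypothesis dyn_cont : continuous (fun y : 'cV[R]_n * 'cV[R]_m => dyn A B y.1 y.2).

Lemma continuous_ocp_cost z (T : topologicalType) (v : T -> nat -> 'cV[R]_m) :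
  (forall j, continuous (v^~ j)) ->
  continuous (fun t => ocp_cost A B l Q P Rm z (v t)).
Proof.
move=> vc; have pc j := @continuous_predicted _ _ _ A B z _ v j dyn_cont vc.
have qc p (M : 'M[R]_p) (f : T -> 'cV[R]_p) :
    continuous f -> continuous (fun t => qform M (f t)).
  move=> fc t; apply: (@continuous_comp _ _ _ f (qform M)); first exact: fc.
  exact: continuous_qform.
have halfc (f : T -> R) : continuous f -> continuous (fun t => 2^-1 * f t).
  by move=> fc t; apply: cvgM; [exact: cvg_cst|exact: fc].
move=> t; apply: cvgD; apply: halfc; first exact/qc.
by apply: continuous_sum => j s; apply: cvgD; apply: qc.
Qed.

Hypotheses (Xclosed : closed X) (Uclosed : closed U) (Xfclosed : closed Xf).

(** Admissibility is a conjunction of closed conditions on quantities that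
    depend continuously on the inputs. *)
Lemma closed_ocp_admissible z :
  closed [set v : {ptws nat -> 'cV[R]_m} | ocp_admissible A B X Xf U l z v].
Proof.
have vc j : continuous (fun v : {ptws nat -> 'cV[R]_m} => v j).
  by move=> w; exact: proj_continuous.
have pc j := @continuous_predicted _ _ _ A B z _ _ j dyn_cont vc.
have -> : [set v : {ptws nat -> 'cV[R]_m} | ocp_admissible A B X Xf U l z v] =
    (\bigcap_(j in [set j | (1 <= j <= l)%N])
        ((fun v : {ptws nat -> 'cV[R]_m} => predicted A B z v j) @^-1` X)) `&`
    (\bigcap_(j in [set j | (1 <= j <= l.-1)%N])
        ((fun v : {ptws nat -> 'cV[R]_m} => v j) @^-1` U)) `&`
    ((fun v : {ptws nat -> 'cV[R]_m} => predicted A B z v l) @^-1` Xf).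
  by apply/seteqP; split=> [v [vX vU vXf]|v [[vX vU] vXf]].
apply: closedI; last by have /continuous_closedP := pc l; exact.
apply: closedI; apply: closed_bigI => j _.
  by have /continuous_closedP := pc j; exact.
by have /continuous_closedP := vc j; exact.
Qed.

Hypotheses (Qpos : possemidef Q) (Ppos : possemidef P) (Rpos : posdef Rm).

Lemma qform_input_le_cost z v j : (1 <= j < l)%N ->
  qform Rm (v j) <= 2 * ocp_cost A B l Q P Rm z v.
Proof.
move=> jl; rewrite /ocp_cost mulrDr !mulrA divff ?pnatr_eq0// !mul1r.
rewrite -[leLHS]add0r lerD//.
rewrite (bigD1_seq j) ?mem_index_iota ?iota_uniq//=.
rewrite -addrA addrCA lerDl addr_ge0// sumr_ge0// => i _.
by rewrite addr_ge0//; exact: posdef_possemidef.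
Qed.

(** A minimum over the compact set S of admissible sequences in the product of
    balls is a global one: a competitor no more expensive than w0 has its
    truncation in S, with the same cost, and any other competitor is more
    expensive than w0. *)
Lemma ocp_minimizer_exists z :
  (exists w, ocp_admissible A B X Xf U l z w) ->
  exists w, ocp_minimizer A B X Xf U l Q P Rm z w.
Proof.
move=> [w0 w0adm].
have [c Rmc] := posdef_sublevel_bounded
  (2 * ocp_cost A B l Q P Rm z w0) Rpos.
(* The absolute value only makes the radius visibly nonnegative, so that the
   zero entries of a truncated sequence lie in the balls. *)
have boxcompact : compact [set v : {ptws nat -> 'cV[R]_m} |
    forall j, `|v j| <= `|c|].
  apply: (@tychonoff nat (fun=> 'cV[R]_m) (fun=> [set y | `|y| <= `|c|])) => _.
  apply: bounded_closed_compact_cV.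
    by exists `|c|; split=> // d cd y /= yc; exact: le_trans yc (ltW cd).
  have /continuous_closedP : continuous (fun x : 'cV[R]_m => `|x|).
    exact: norm_continuous.
  by move=> /(_ [set r | r <= `|c|]); apply; exact: closed_le.
pose S := [set v : {ptws nat -> 'cV[R]_m} | forall j, `|v j| <= `|c|] `&`
  [set v | ocp_admissible A B X Xf U l z v].
have Scompact : compact S by apply: compact_closedI => //; exact: closed_ocp_admissible.
have inS w : ocp_admissible A B X Xf U l z w ->
    ocp_cost A B l Q P Rm z w <= ocp_cost A B l Q P Rm z w0 -> S (truncated w).
  move=> wadm ww0; split; last exact: ocp_admissible_truncated.
  move=> j; rewrite /truncated; case: ifPn => jl; last by rewrite normr0.
  apply: le_trans (ler_norm c); apply: Rmc.
  by apply: le_trans (qform_input_le_cost z w jl) _; rewrite ler_pM2l.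
have Jcont : continuous (fun v : {ptws nat -> 'cV[R]_m} =>
    ocp_cost A B l Q P Rm z v).
  by apply: (@continuous_ocp_cost z {ptws nat -> 'cV[R]_m} id) => j v;
    exact: proj_continuous.
have [|v /set_mem[_ vadm] vmin] :=
    compact_EVT_min _ Scompact (continuous_subspaceT Jcont).
  by exists (truncated w0); exact: inS.
have vw0 : ocp_cost A B l Q P Rm z v <= ocp_cost A B l Q P Rm z w0.
  by rewrite -(ocp_cost_truncated z w0); exact/vmin/mem_set/inS.
exists v; split=> // w wadm.
have [ww0|/ltW] := leP (ocp_cost A B l Q P Rm z w) (ocp_cost A B l Q P Rm z w0).
  by rewrite -(ocp_cost_truncated z w); exact/vmin/mem_set/inS.
exact: le_trans.
Qed.

End Existence.

(** * Recursive feasibility *)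

Lemma continuous_dyn (R : realType) n m
    (A : 'cV[R]_n -> 'cV[R]_m -> 'M[R]_n)
    (B : 'cV[R]_n -> 'cV[R]_m -> 'M[R]_(n, m)) :
  continuous (fun z : 'cV[R]_n * 'cV[R]_m => A z.1 z.2) ->
  continuous (fun z : 'cV[R]_n * 'cV[R]_m => B z.1 z.2) ->
  continuous (fun z : 'cV[R]_n * 'cV[R]_m => dyn A B z.1 z.2).
Proof.
move=> Ac Bc z; apply: cvgD; apply: continuous_mulmx => // y.
- exact: cvg_fst.
- exact: cvg_snd.
Qed.

(** One step of the closed loop drops the first state of the prediction. *)
Lemma predicted_shift (R : realType) n m
    (A : 'cV[R]_n -> 'cV[R]_m -> 'M[R]_n)
    (B : 'cV[R]_n -> 'cV[R]_m -> 'M[R]_(n, m)) z v j :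
  predicted A B (dyn A B z.1 z.2, v 1%N) (fun i => v i.+1) j =
  predicted A B z v j.+1.
Proof. by elim: j => [//|[//|j] IH]; rewrite predictedS IH. Qed.

(** The witness is the sequence v extended by the terminal feedback at index l,
    then shifted by one. *)
Lemma feasible_set_next (R : realType) n m l
    (A : 'cV[R]_n -> 'cV[R]_m -> 'M[R]_n)
    (B : 'cV[R]_n -> 'cV[R]_m -> 'M[R]_(n, m))
    (X Xf : set 'cV[R]_n) (U : set 'cV[R]_m) (K : 'cV[R]_n -> 'cV[R]_m) z v :
  (2 <= l)%N ->
  (forall x, Xf x -> U (K x)) -> (forall x, Xf x -> Xf (dyn A B x (K x))) ->
  ocp_admissible A B X Xf U l z v ->
  feasible_set A B X Xf U l (dyn A B z.1 z.2, v 1%N).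
Proof.
case: l => [//|[//|l]] _ KU KXf [vX vU vXf].
pose w j := if (j <= l.+1)%N then v j else K (predicted A B z v l.+2).
have wv j : (j <= l.+2)%N -> predicted A B z w j = predicted A B z v j.
  move=> jl; apply: predicted_ext => i /andP[_ ij].
  by rewrite /w -ltnS (leq_trans ij jl).
rewrite (_ : v 1%N = w 1%N)//; exists (fun i => w i.+1); split=> [j|j|].
- move=> /andP[j1 jl]; rewrite /w; case: ifPn => [jl'|_]; last exact: KU.
  by apply: vU; rewrite /= jl'.
- move=> /andP[j1 jl]; rewrite predicted_shift wv//; exact: vX.
- by rewrite predicted_shift predictedS wv// /w ltnn; exact: KXf.
Qed.

Theorem theorem1 (R : realType) (n m l : nat) (hl : (2 <= l)%N)
  (A : 'cV[R]_n -> 'cV[R]_m -> 'M[R]_n)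
  (B : 'cV[R]_n -> 'cV[R]_m -> 'M[R]_(n, m))
  (X : set 'cV[R]_n) (U : set 'cV[R]_m)
  (Xclosed : closed X) (Uclosed : closed U)
  (Q : 'M[R]_n) (Rm : 'M[R]_m)
  (Qsym : Q^T = Q) (Rsym : Rm^T = Rm) (Rpos : posdef Rm)
  (* (A1) *)
  (A_C1 : continuously_differentiable (fun z : 'cV[R]_n * 'cV[R]_m => A z.1 z.2))
  (B_C1 : continuously_differentiable (fun z : 'cV[R]_n * 'cV[R]_m => B z.1 z.2))
  (A_lip : exists2 LA : R, 0 < LA & lipschitz_mx LA A)
  (B_lip : exists2 LB : R, 0 < LB & lipschitz_mx LB B)
  (* (A3) *)
  (AB_stab : stabilizable (A 0 0) (B 0 0))
  (AQ_det : exists2 Qhalf : 'M[R]_n, is_sqrtmx Q Qhalf & detectable (A 0 0) Qhalf)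
  (Qpos : posdef Q)
  (X0 : interior X 0) (U0 : interior U 0)
  (* terminal ingredients *)
  (P : 'M[R]_n) (hP : stabilizing_solution (A 0 0) (B 0 0) Q Rm P)
  (alpha : R) (alpha_gt0 : 0 < alpha)
  (halpha : terminal_conditions A B Q Rm X U P (gain (A 0 0) (B 0 0) Rm P) alpha)
  (* closed loop *)
  (x : nat -> 'cV[R]_n) (u : nat -> 'cV[R]_m) (v : nat -> nat -> 'cV[R]_m)
  (hcl : receding_horizon A B X (sublevel P alpha) U l Q P Rm x u v)
  (z0F : feasible_set A B X (sublevel P alpha) U l (x 0%N, u 0%N)) :
  forall k : nat, feasible_set A B X (sublevel P alpha) U l (x k, u k).
Proof.
have [PX KXf _] := halpha; case: PX => XfX KU.
have dc : continuous (fun z : 'cV[R]_n * 'cV[R]_m => dyn A B z.1 z.2).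
  apply: continuous_dyn => z.
    exact: differentiable_continuous (A_C1.1 z).
  exact: differentiable_continuous (B_C1.1 z).
have Xfclosed : closed (sublevel P alpha).
  have /continuous_closedP := @continuous_qform R n P.
  by move=> /(_ [set r | r <= alpha]); apply; exact: closed_le.
have [_ Ppos _ _] := hP.
elim=> [//|k [w [wU wX wXf]]].
have [xS uS vmin] := hcl k.
have [] := vmin.
  apply: ocp_minimizer_exists => //; try exact: posdef_possemidef.
  exists w; split=> // j /andP[j1]; rewrite leq_eqVlt => /predU1P[->|jl].
    exact: XfX.
  by apply: wX; rewrite j1 -ltnS prednK// (ltn_trans _ jl).
move=> vadm _; rewrite xS uS.
exact: feasible_set_next hl KU KXf vadm.
Qed.
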